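(* Let $Q=(q_{ij})$ be the conservative $Q$-matrix on $E=\{0,1,2,\ldots\}$ with $q_{i,i+1}=i+1$ for $i\ge0$, $q_{i0}=\alpha_i\ge0$ for $i\ge1$, and $q_{ij}=0$ for all other $i\ne j$, where infinitely many of the $\alpha_i$ are non-zero (so that $Q$ is irreducible). If $\lim_{i\to\infty}\alpha_i=0$, then the $Q$-process is non-exponentially ergodic.
   Context: Conservative means $q_i:=-q_{ii}=\sum_{j\ne i}q_{ij}$. The $Q$-process is the continuous-time Markov chain $(X_t)_{t\ge0}$ with $Q$-matrix $Q$ (it is unique) and transition probabilities $p_{ij}(t)$. It is exponentially ergodic if, with $\pi$ its stationary probability distribution, there is $\beta>0$ such that for each $i,j\in E$, $|p_{ij}(t)-\pi_j|=O(e^{-\beta t})$ as $t\to\infty$. Known equivalent description: with $\eta_1$ the first jump time and $\sigma_H=\inf\{t\ge\eta_1: X_t\in H\}$, the process is exponentially ergodic iff $\max_{i\in H}\mathbf{E}_i e^{\lambda\sigma_H}<\infty$ for some $\lambda>0$ with $\lambda<q_i$ for all $i\in E$ and some (equivalently, any) non-empty finite $H\subseteq E$. *)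

(* Defs.v *)
From HB Require Import structures.
From mathcomp Require Import all_boot all_order all_algebra.
From mathcomp Require Import all_classical all_reals all_analysis.
Set Implicit Arguments.
Unset Strict Implicit.
Unset Printing Implicit Defensive.
Import Order.TTheory GRing.Theory Num.Theory.
Import numFieldNormedType.Exports.
Local Open Scope classical_set_scope.
Local Open Scope ring_scope.

(* The state space E = {0, 1, 2, ...} is nat. *)

Record conservative_Qmatrix (R : realType) (Q : nat -> nat -> R) : Prop := {
  Qmatrix_ge0 : forall i j, i != j -> 0 <= Q i j ;
  Qmatrix_conservative : forall i,
    series (fun j => if j == i then 0 else Q i j) @ \oo --> - Q i i }.

(* [p t i j] is p_ij(t); its values at t < 0 are irrelevant. *)
Record transition_function (R : realType) (p : R -> nat -> nat -> R) : Prop := {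
  transition_ge0 : forall t i j, 0 <= t -> 0 <= p t i j ;
  transition_sum1 : forall t i, 0 <= t -> series (p t i) @ \oo --> (1 : R) ;
  transition_0 : forall i j, p 0 i j = (i == j)%:R ;
  transition_Chapman_Kolmogorov : forall s t i j, 0 <= s -> 0 <= t ->
    series (fun k => p s i k * p t k j) @ \oo --> p (s + t) i j }.

(* A Q-process is identified with its transition function. The derivative
   condition p'(0+) = Q entails that p is standard, i.e. continuous at 0+. *)
Record Qprocess (R : realType) (Q : nat -> nat -> R) (p : R -> nat -> nat -> R)
    : Prop := {
  Qprocess_transition : transition_function p ;
  Qprocess_derivative : forall i j,
    (p h i j - (i == j)%:R) / h @[h --> 0^'+] --> Q i j }.

Record stationary_distribution (R : realType) (p : R -> nat -> nat -> R)
    (pi_ : nat -> R) : Prop := {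
  stationary_ge0 : forall j, 0 <= pi_ j ;
  stationary_sum1 : series pi_ @ \oo --> (1 : R) ;
  stationary_invariant : forall t j, 0 <= t ->
    series (fun i => pi_ i * p t i j) @ \oo --> pi_ j }.

(* The rate beta is the same for all i, j, but the constant C of the
   O(exp (- beta t)) bound may depend on i and j. *)
Definition exponentially_ergodic (R : realType) (p : R -> nat -> nat -> R)
    : Prop :=
  exists pi_ : nat -> R, stationary_distribution p pi_ /\
  exists2 beta : R, 0 < beta & forall i j,
    exists C : R,
    \forall t \near +oo, `|p t i j - pi_ j| <= C * expR (- beta * t).

(* Main.v *)
(* Observe the process at integer times. Put u_n = p_00(n) and let G_n be the
   probability that the chain started at 0 is not at 0 at the times 1, ..., n.
   Splitting at the last visit to 0 gives sum_(k <= n) u_k G_(n-k) = 1. If u_n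
   converges exponentially fast to pi_0 > 0, then G_n decays exponentially:
   with T_n = 1 / pi_0 - sum_(m <= n) G_m and A_n = sum_(k <= n) r^k G_(n-k), the
   renewal equation gives T_n <= C A_n, while L_n = T_n + A_n satisfies
   L_(n+1) = T_n + r A_n, so L_(n+1) <= rho L_n for some rho < 1.
   On the other hand, once alpha_i < e for all i >= N, the process started at
   i >= N is in {0, ..., N - 1} at time 1 with probability at most e, hence
   G_(n+1) >= p_0N(1) (1 - e)^n; this contradicts the decay when 1 - e > rho. *)
Require Import Defs.
From HB Require Import structures.
From mathcomp Require Import all_boot all_order all_algebra.
From mathcomp Require Import all_classical all_reals all_analysis.
From mathcomp Require Import ring lra zify.
Import Order.TTheory GRing.Theory Num.Theory.
Import numFieldNormedType.Exports.
Local Open Scope classical_set_scope.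
Local Open Scope ring_scope.
Set Implicit Arguments.
Unset Strict Implicit.
Unset Printing Implicit Defensive.

(** * Sums and comparison of convergent series *)

Section Series.
Context {R : realType}.
Implicit Types (a b : nat -> R) (x y c : R).

Lemma cvg_seriesD a b x y :
    series a @ \oo --> x -> series b @ \oo --> y ->
  series (fun k => a k + b k) @ \oo --> x + y.
Proof.
by move=> ax by_; rewrite [series _](seriesD a b); exact: cvgD.
Qed.

Lemma cvg_seriesZ c a x :
  series a @ \oo --> x -> series (fun k => c * a k) @ \oo --> c * x.
Proof.
move=> ax; rewrite [series _](_ : _ = fun n => c * series a n).
  exact: cvgMr.
by apply/funext => n; rewrite /series /= big_distrr.
Qed.

Lemma cvg_series_sum n (f : nat -> nat -> R) (l : nat -> R) :
    (forall j, (j < n)%N -> series (f j) @ \oo --> l j) ->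
  series (fun k => \sum_(j < n) f j k) @ \oo --> \sum_(j < n) l j.
Proof.
elim: n => [_|n IH fl].
  under eq_fun do rewrite big_ord0.
  rewrite big_ord0 [series _](_ : _ = fun=> 0); first exact: cvg_cst.
  by apply/funext => n; rewrite /series /= big1.
under eq_fun do rewrite big_ord_recr.
rewrite big_ord_recr; apply: cvg_seriesD; last exact: fl.
by apply: IH => j jn; apply/fl/ltnW.
Qed.

(** Adding such a series changes one term of a convergent series; the comparisons below single out
    or cancel finitely many terms in this way. *)
Lemma cvg_series_delta i c : series (fun k => (k == i)%:R * c) @ \oo --> c.
Proof.
apply: cvg_near_cst; near=> n.
have ni : (i < n)%N by near: n; exact: nbhs_infty_gt.
rewrite seriesEord /= (bigD1 (Ordinal ni)) //= eqxx mul1r big1 ?addr0 // => k.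
by rewrite -val_eqE /= => /negPf ->; rewrite mul0r.
Unshelve. all: by end_near. Qed.

Lemma ler_cvg_series a b x y :
    series a @ \oo --> x -> series b @ \oo --> y -> (forall k, a k <= b k) ->
  x <= y.
Proof.
move=> ax by_ ab; apply: (ler_cvg_to ax by_).
by near=> n; apply: ler_sum => k _.
Unshelve. all: by end_near. Qed.

Lemma cvg_series_ge_term a x i :
  (forall k, 0 <= a k) -> series a @ \oo --> x -> a i <= x.
Proof.
move=> a0 ax; apply: (ler_cvg_series (@cvg_series_delta i (a i)) ax) => k.
by have [->|_] := eqVneq k i; rewrite ?mul1r ?mul0r.
Qed.

Lemma is_cvg_series_le a b x :
    (forall k, 0 <= a k <= b k) -> series b @ \oo --> x ->
  series a @ \oo --> limn (series a).
Proof.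
move=> ab bx; have a0 k : 0 <= a k by case/andP: (ab k).
have leab k : a k <= b k by case/andP: (ab k).
apply: (series_le_cvg a0 _ leab) => [k|]; first exact: le_trans (leab k).
by apply/cvg_ex; exists x.
Qed.

End Series.

(** * Exponential decay from the renewal equation *)

Lemma renewal_decay (R : realType) (u G : nat -> R) (l C r : R) :
    0 < l -> 0 < r < 1 ->
    (forall n, 0 <= u n) -> (forall n, 0 <= G n) ->
    (forall n, \sum_(k < n.+1) u k * G (n - k)%N = 1) ->
    (forall n, `|u n - l| <= C * r ^+ n) ->
  exists K rho, 0 < rho < 1 /\ forall n, G n <= K * rho ^+ n.
Proof.
move=> l0 /andP[r0 r1] u0 G0 uG ul.
have C0 : 0 <= C by have := le_trans (normr_ge0 _) (ul 0%N); rewrite expr0 mulr1.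
pose A n : R := \sum_(k < n.+1) r ^+ k * G (n - k)%N.
pose S n : R := \sum_(k < n.+1) G k.
have AS n : A n.+1 = r * A n + G n.+1.
  rewrite /A big_ord_recl expr0 mul1r subn0 addrC; congr (_ + _).
  by rewrite big_distrr; apply: eq_bigr => k _; rewrite /= exprS mulrA.
have SE n : S n = \sum_(k < n.+1) G (n - k)%N.
  rewrite /S (reindex_inj rev_ord_inj) /=.
  by apply: eq_bigr => k _; rewrite subSS.
have SS n : S n.+1 = S n + G n.+1 by rewrite /S big_ord_recr.
have Sle M : l * S M <= 1.
  (* In the renewal identity at time [n + M], keep only the terms where the index of [u] is at least
     [n]: there [u] is at least [l - C * r ^+ n]. Then let [n] tend to infinity. *)
  have S_le n : (l - C * r ^+ n) * S M <= 1.
    rewrite -(uG (n + M)%N) (reindex_inj rev_ord_inj) /= -addnS.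
    rewrite addnC big_split_ord /= -[leLHS]addr0.
    apply: lerD; last by apply: sumr_ge0 => k _; rewrite mulr_ge0.
    rewrite /S big_distrr /=; apply: ler_sum => k _.
    have kM : (k <= M)%N by rewrite -ltnS.
    have -> : (M.+1 + n - k.+1 = n + (M - k))%N by lia.
    have -> : (n + M - (n + (M - k)) = k)%N by lia.
    apply: ler_wpM2r => //.
    have := ul (n + (M - k))%N; rewrite ler_norml => /andP[+ _].
    rewrite lerBrDr addrC; apply: le_trans.
    rewrite lerD2l lerN2 ler_wpM2l // exprD ler_piMr ?exprn_ge0 ?exprn_ile1 //; exact: ltW.
  have cv : (fun n => (l - C * r ^+ n) * S M) @ \oo --> (l - C * 0) * S M.
    apply: cvgMl; apply: cvgB; first exact: cvg_cst.
    by apply: cvgMr; apply: cvg_expr; rewrite gtr0_norm.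
  have -> : l * S M = (l - C * 0) * S M by rewrite mulr0 subr0.
  by apply: (cvgr_to_le cv); near=> n; exact: S_le.
have TA n : 1 - l * S n <= C * A n.
  rewrite -(uG n) SE /A !big_distrr -sumrB ler_sum // => k _ /=.
  rewrite mulrA -mulrBl ler_wpM2r //.
  exact: le_trans (ler_norm _) (ul _).
(* [L n] dominates [G n], and [L n - L n.+1] is at least a fixed fraction of [L n]. *)
pose L n := (1 - l * S n) / l + A n.
pose D := C / l + 1.
have D1 : 1 <= D by rewrite lerDr divr_ge0 // ltW.
have D0 : 0 < D by lra.
have LD n : L n <= D * A n.
  rewrite /L /D [leRHS]mulrDl mul1r lerD2r mulrAC.
  by apply: ler_wpM2r => //; rewrite invr_ge0 ltW.
have LS n : L n.+1 = L n - (1 - r) * A n.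
  rewrite /L SS AS; field; exact: lt0r_neq0.
(* By [LD], [A n] is at least [L n / D], so by [LS] each step removes at least the fraction
   [(1 - r) / D] of [L n]. *)
pose rho := 1 - (1 - r) / D.
have rhoP : 0 < rho < 1.
  rewrite /rho subr_gt0 gtrBl divr_gt0 ?subr_gt0 // andbT.
  rewrite ltr_pdivrMr // mul1r; lra.
have LSrho n : L n.+1 <= rho * L n.
  have h : (1 - r) / D * L n <= (1 - r) * A n.
    rewrite -mulrA; apply: ler_wpM2l; first by rewrite subr_ge0 ltW.
    by rewrite mulrC ler_pdivrMr // mulrC; exact: LD.
  rewrite LS /rho; lra.
have Lrho n : L n <= L 0%N * rho ^+ n.
  elim: n => [|n IH]; first by rewrite expr0 mulr1.
  apply: le_trans (LSrho n) _.
  by rewrite exprS mulrCA ler_pM2l //; case/andP: rhoP.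
exists (L 0%N), rho; split => // n; apply: le_trans (Lrho n).
have GA : G n <= A n.
  rewrite /A big_ord_recl expr0 mul1r subn0 lerDl sumr_ge0 // => k _.
  by rewrite mulr_ge0 // exprn_ge0 // ltW.
apply: le_trans GA _; rewrite /L lerDr.
by apply: divr_ge0 (ltW l0); rewrite subr_ge0.
Unshelve. all: by end_near. Qed.

(** * Transition functions and avoidance of 0 at integer times *)

Section Transition.
Context {R : realType}.
Implicit Types (p : R -> nat -> nat -> R) (P : nat -> nat -> R) (s t : R).

Lemma transition_mul_le p s t i j k :
    transition_function p -> 0 <= s -> 0 <= t ->
  p s i k * p t k j <= p (s + t) i j.
Proof.
move=> Tp s0 t0.
apply: (cvg_series_ge_term k _ (transition_Chapman_Kolmogorov Tp s0 t0)).
by move=> m; rewrite mulr_ge0 ?(transition_ge0 Tp).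
Qed.

Lemma transition_sum_le1 p t i n :
  transition_function p -> 0 <= t -> \sum_(j < n) p t i j <= 1.
Proof.
move=> Tp t0.
have dl := cvg_series_sum (fun j (_ : (j < n)%N) => @cvg_series_delta R j (p t i j)).
apply: (ler_cvg_series dl (transition_sum1 Tp i t0)) => k.
have [kn|nk] := ltnP k n.
  rewrite (bigD1 (Ordinal kn)) //= eqxx mul1r big1 ?addr0 // => j.
  by rewrite -val_eqE /= eq_sym => /negPf ->; rewrite mul0r.
rewrite big1 ?(transition_ge0 Tp) // => j _.
by rewrite gtn_eqF ?mul0r // (leq_trans (ltn_ord j)).
Qed.

Lemma transition_le1 p t i j : transition_function p -> 0 <= t -> p t i j <= 1.
Proof.
move=> Tp t0; apply: cvg_series_ge_term (transition_sum1 Tp i t0) => k.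
exact: transition_ge0.
Qed.

Lemma transition_diag_succ_le1 p t i :
  transition_function p -> 0 <= t -> p t i i + p t i i.+1 <= 1.
Proof.
move=> Tp t0; apply: le_trans (transition_sum_le1 i i.+2 Tp t0).
rewrite !big_ord_recr /= -addrA lerDr sumr_ge0 // => j _.
exact: transition_ge0.
Qed.

(* [avoid0 P n i] is the probability that the chain with transition matrix [P]
   started at [i] is not at [0] at the times [1, ..., n]. *)
Fixpoint avoid0 P n i : R :=
  if n is m.+1
  then limn (series (fun j => (j != 0%N)%:R * (P i j * avoid0 P m j)))
  else 1.

(** The limit in [avoid0] is meaningful only if the series converges. Domination by [P i] gives this
    once [avoid0 P n] lies in [0, 1], and convergence in turn carries the bounds to [n.+1]. *)
Lemma avoid0_bounds P n i :
    (forall i j, 0 <= P i j) -> (forall i, series (P i) @ \oo --> (1 : R)) ->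
  [/\ 0 <= avoid0 P n i <= 1 &
    series (fun j => (j != 0%N)%:R * (P i j * avoid0 P n j)) @ \oo
      --> avoid0 P n.+1 i].
Proof.
move=> P0 P1.
have cv m : (forall j, 0 <= avoid0 P m j <= 1) -> forall i,
    series (fun j => (j != 0%N)%:R * (P i j * avoid0 P m j)) @ \oo
      --> avoid0 P m.+1 i.
  move=> bd j; apply: is_cvg_series_le (P1 j) => k.
  have /andP[a0 a1] := bd k.
  case: (k != 0%N); rewrite ?mul1r ?mul0r ?lexx ?P0 // mulr_ge0 //=.
  exact: ler_piMr.
have bd m : forall j, 0 <= avoid0 P m j <= 1.
  elim: m => [|m IH] j; first by rewrite /= ler01 lexx.
  have tm k : 0 <= (k != 0%N)%:R * (P j k * avoid0 P m k) <= P j k.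
    have /andP[a0 a1] := IH k.
    case: (k != 0%N); rewrite ?mul1r ?mul0r ?lexx ?P0 // mulr_ge0 //=.
    exact: ler_piMr.
  apply/andP; split.
    apply: le_trans (cvg_series_ge_term 0%N _ (cv m IH j)) => [|k].
      by case/andP: (tm 0%N).
    by case/andP: (tm k).
  by apply: (ler_cvg_series (cv m IH j) (P1 j)) => k; case/andP: (tm k).
by split; [exact: bd | exact: cv].
Qed.

Lemma avoid0_step P n i :
    (forall i j, 0 <= P i j) -> (forall i, series (P i) @ \oo --> (1 : R)) ->
  series (fun j => P i j * avoid0 P n j) @ \oo
    --> avoid0 P n.+1 i + P i 0%N * avoid0 P n 0%N.
Proof.
move=> P0 P1; have [_ cv] := avoid0_bounds n i P0 P1.
have := cvg_seriesD cv (@cvg_series_delta R 0%N (P i 0%N * avoid0 P n 0%N)).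
under [X in series X]eq_fun => j.
  rewrite (_ : _ + _ = P i j * avoid0 P n j); first over.
  by case: j => [|j]; rewrite !(mul0r, mul1r, add0r, addr0).
by [].
Qed.

(* Decomposition of the trajectory at its last visit to [0]. *)
Lemma avoid0_renewal p n i : transition_function p ->
  avoid0 (p 1) n i +
    \sum_(k < n) p k.+1%:R i 0%N * avoid0 (p 1) (n - k.+1) 0%N = 1.
Proof.
move=> Tp.
have P0 i' j : 0 <= p 1 i' j by exact: transition_ge0.
have P1 i' : series (p 1 i') @ \oo --> (1 : R) by exact: transition_sum1.
elim: n i => [|n IH] i; first by rewrite big_ord0 addr0.
(* Condition on the first step and compute one series in two ways: here by Chapman-Kolmogorov, and
   in [cv1] by the induction hypothesis, which reduces its terms to [p 1 i j]. *)
have cv : series (fun j => p 1 i j * avoid0 (p 1) n j +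
    \sum_(k < n) avoid0 (p 1) (n - k.+1) 0%N * (p 1 i j * p k.+1%:R j 0%N))
    @ \oo --> avoid0 (p 1) n.+1 i + p 1 i 0%N * avoid0 (p 1) n 0%N +
    \sum_(k < n) avoid0 (p 1) (n - k.+1) 0%N * p (1 + k.+1%:R) i 0%N.
  apply: cvg_seriesD; first exact: avoid0_step.
  apply: (cvg_series_sum
    (f := fun k j => avoid0 (p 1) (n - k.+1) 0%N * (p 1 i j * p k.+1%:R j 0%N))
    (l := fun k => avoid0 (p 1) (n - k.+1) 0%N * p (1 + k.+1%:R) i 0%N)) => k _.
  by apply: cvg_seriesZ; exact: transition_Chapman_Kolmogorov.
have cv1 : series (fun j => p 1 i j * avoid0 (p 1) n j +
    \sum_(k < n) avoid0 (p 1) (n - k.+1) 0%N * (p 1 i j * p k.+1%:R j 0%N))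
    @ \oo --> (1 : R).
  rewrite [X in series X](_ : _ = p 1 i) //; apply/funext => j.
  rewrite -[RHS]mulr1; move: (IH j) => /(congr1 ( *%R (p 1 i j))) <-.
  rewrite mulrDr big_distrr; congr (_ + _).
  by apply: eq_bigr => k _; rewrite /= mulrCA [_ * p k.+1%:R _ _]mulrC.
rewrite -[RHS](cvg_unique _ cv cv1) // big_ord_recl subSS subn0 addrA.
congr (_ + _); apply: eq_bigr => k _.
by rewrite mulrC lift0 subSS nat1r.
Qed.

(** From a state at least [N], a step stays in this region with probability at least [1 - e], and
    the region does not contain 0. *)
Lemma avoid0_ge P N e n i :
    (forall i j, 0 <= P i j) -> (forall i, series (P i) @ \oo --> (1 : R)) ->
    (0 < N)%N -> e <= 1 ->
    (forall i, (N <= i)%N -> \sum_(j < N) P i j <= e) ->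
    (N <= i)%N ->
  (1 - e) ^+ n <= avoid0 P n i.
Proof.
move=> P0 P1 N0 e1 Pe; elim: n i => [|n IH] i Ni; first by rewrite expr0.
have [_ cv] := avoid0_bounds n i P0 P1.
have th0 : 0 <= (1 - e) ^+ n by rewrite exprn_ge0 // subr_ge0.
(* This series is [(1 - e) ^+ n * P i k] restricted to [k >= N], written as the full series minus
   finitely many terms. *)
have cv' : series (fun k => (1 - e) ^+ n * P i k +
      - (1 - e) ^+ n * \sum_(j < N) (k == j)%:R * P i j) @ \oo
    --> (1 - e) ^+ n * 1 + - (1 - e) ^+ n * \sum_(j < N) P i j.
  apply: cvg_seriesD; first exact: cvg_seriesZ.
  apply: cvg_seriesZ.
  apply: (cvg_series_sum (f := fun j k => (k == j)%:R * P i j)) => j _.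
  exact: cvg_series_delta.
have le1 : (1 - e) ^+ n.+1 <=
    (1 - e) ^+ n * 1 + - (1 - e) ^+ n * \sum_(j < N) P i j.
  by rewrite mulNr -mulrBr exprSr ler_wpM2l // lerD2l lerN2 Pe.
apply: le_trans le1 _; apply: (ler_cvg_series cv' cv) => k.
have [kN|Nk] := ltnP k N.
  rewrite (bigD1 (Ordinal kN)) //= eqxx mul1r big1 ?addr0 => [|j].
    rewrite mulNr subrr mulr_ge0 // mulr_ge0 //.
    by have [/andP[]] := avoid0_bounds n k P0 P1.
  by rewrite -val_eqE /= eq_sym => /negPf ->; rewrite mul0r.
rewrite big1 => [|j _]; last first.
  by rewrite gtn_eqF ?mul0r // (leq_trans (ltn_ord j)).
rewrite mulr0 addr0 -lt0n (leq_trans N0 Nk) mul1r mulrC.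
by apply: ler_wpM2l => //; exact: IH.
Qed.

End Transition.

(** * Short-time estimates and positivity for the process *)

Section Qprocess.
Context {R : realType}.
Implicit Types (Q : nat -> nat -> R) (p : R -> nat -> nat -> R).

Lemma near_forall_ltn {T : Type} (F : set_system T) {FF : Filter F}
    (P : nat -> T -> Prop) n :
    (forall i, (i < n)%N -> \forall x \near F, P i x) ->
  \forall x \near F, forall i, (i < n)%N -> P i x.
Proof.
elim: n => [|n IH] FP; first by near=> x => i; rewrite ltn0.
have {}IH := IH (fun i ni => FP i (ltnW ni)).
have Pn := FP n (ltnSn n).
near=> x => i; rewrite ltnS leq_eqVlt => /predU1P[->|]; first by near: x.
by move: i; near: x.
Unshelve. all: by end_near. Qed.

(** Replaces all small times by one of the form 1/(n+1), so that [n.+1] equal steps fill a unit of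
    time exactly. *)
Lemma near_right0_harmonic (P : R -> Prop) :
  (\forall s \near 0^'+, P s) -> exists n, P n.+1%:R^-1.
Proof.
move=> [e /= e0 eP]; have := near_infty_natSinv_lt (PosNum e0).
case=> n _ /(_ n (leqnn n)) /= ne; exists n; apply: eP; last first.
  by rewrite invr_gt0.
by rewrite /ball_ /= sub0r normrN gtr0_norm ?invr_gt0.
Qed.

Lemma Qprocess_near_le Q p i j c : Qprocess Q p -> i != j -> Q i j < c ->
  \forall s \near 0^'+, p s i j <= c * s.
Proof.
move=> Qp ij Qc; have H := cvgr_le _ (@Qprocess_derivative _ _ _ Qp i j) _ Qc.
near=> s; have s0 : 0 < s by near: s; exact: nbhs_right_gt.
have : (p s i j - (i == j)%:R) / s <= c by near: s; exact: H.
by rewrite (negPf ij) subr0 ler_pdivrMr.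
Unshelve. all: by end_near. Qed.

Lemma Qprocess_near_gt0 Q p i j : Qprocess Q p -> i != j -> 0 < Q i j ->
  \forall s \near 0^'+, 0 < p s i j.
Proof.
move=> Qp ij Q0; have H := cvgr_gt _ (@Qprocess_derivative _ _ _ Qp i j) _ Q0.
near=> s; have s0 : 0 < s by near: s; exact: nbhs_right_gt.
have : 0 < (p s i j - (i == j)%:R) / s by near: s; exact: H.
by rewrite (negPf ij) subr0 pmulr_lgt0 // invr_gt0.
Unshelve. all: by end_near. Qed.

Lemma Qprocess_near_diag_gt0 Q p i : Qprocess Q p ->
  \forall s \near 0^'+, 0 < p s i i.
Proof.
move=> Qp; pose c : R := `|Q i i| + 1.
have c0 : 0 < c by rewrite ltr_pwDr.
have Qc : - c < Q i i.
  by rewrite ltrNl (le_lt_trans (ler_norm _)) // normrN ltrDl.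
have H := cvgr_gt _ (@Qprocess_derivative _ _ _ Qp i i) _ Qc.
near=> s; have s0 : 0 < s by near: s; exact: nbhs_right_gt.
have : - c < (p s i i - (i == i)%:R) / s by near: s; exact: H.
rewrite eqxx mulr1n ltr_pdivlMr // mulNr => cs.
have : s < c^-1 by near: s; apply: nbhs_right_lt; rewrite invr_gt0.
rewrite -[c^-1]mul1r ltr_pdivlMr // mulrC => cs1; lra.
Unshelve. all: by end_near. Qed.

(** p_ii(t) is at least the (n+1)-st power of p_ii(t/(n+1)), which is positive for a suitable n by
    the derivative at 0. *)
Lemma Qprocess_diag_gt0 Q p i t : Qprocess Q p -> 0 < t -> 0 < p t i i.
Proof.
move=> Qp t0; have Tp := Qprocess_transition Qp.
have : \forall s \near 0^'+, 0 < p (s * t) i i.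
  case: (Qprocess_near_diag_gt0 i Qp) => e /= e0 eP.
  exists (e / t) => /= [|s se s0]; first exact: divr_gt0.
  apply: eP; last exact: mulr_gt0.
  move: se; rewrite /ball_ /= !sub0r !normrN !gtr0_norm ?mulr_gt0 //.
  by rewrite ltr_pdivlMr.
case/near_right0_harmonic => n; set s := _ * t => ps.
have s0 : 0 <= s by rewrite mulr_ge0 ?invr_ge0 ?ltW.
have -> : t = n.+1%:R * s by rewrite /s mulrA mulfV ?mul1r // pnatr_eq0.
elim: n.+1 => [|m IH]; first by rewrite mul0r (transition_0 Tp) eqxx.
rewrite -natr1 mulrDl mul1r.
apply: lt_le_trans (transition_mul_le i i i Tp _ s0); first exact: mulr_gt0.
by rewrite mulr_ge0.
Qed.

(** Climb [k] states during [t - s], then make the last upward jump during a short time [s]. *)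
Lemma Qprocess_up_gt0 Q p i k t : Qprocess Q p ->
  (forall i, 0 < Q i i.+1) -> 0 < t -> 0 < p t i (i + k)%N.
Proof.
move=> Qp Qup; have Tp := Qprocess_transition Qp.
elim: k t => [|k IH] t t0; first by rewrite addn0; exact: Qprocess_diag_gt0 Qp t0.
near (0 : R)^'+ => s.
have s0 : 0 < s by near: s; exact: nbhs_right_gt.
have st : s < t by near: s; exact: nbhs_right_lt.
rewrite -(subrK s t) addnS.
apply: lt_le_trans (transition_mul_le i _ (i + k) Tp _ (ltW s0)); last first.
  by rewrite subr_ge0 ltW.
rewrite mulr_gt0 ?IH ?subr_gt0 //; near: s.
by apply: Qprocess_near_gt0 Qp _ (Qup _); rewrite neq_ltn ltnSn.
Unshelve. all: by end_near. Qed.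

(* From [k >= N] the process enters [{0, ..., N - 1}] during a short time [s]
   only by a jump, at rate at most [e]. The term in [d] controls the states
   [i >= M], for which the estimates on [p s] are not uniform: [i + 1] grows
   like [exp t] in mean along the process. *)
Lemma Qprocess_hit_le_approx p N M e d n i :
    transition_function p -> 0 <= e -> 0 <= d -> 1 <= d * M.+1%:R ->
    (forall i, (N <= i < M)%N ->
      p n.+1%:R^-1 i i.+1 <= i.+1%:R *+ 2 * n.+1%:R^-1 /\
      1 - p n.+1%:R^-1 i i - p n.+1%:R^-1 i i.+1 <= e * n.+1%:R^-1) ->
    (N <= i)%N ->
  \sum_(j < N) p 1 i j <= e + d * i.+1%:R * expR 2.
Proof.
move=> Tp e0 d0 dM; set s := n.+1%:R^-1 => Hs.
have s0 : 0 < s by rewrite invr_gt0.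
pose g t i := \sum_(j < N) p t i j.
have g1 t k : 0 <= t -> g t k <= 1 by exact: transition_sum_le1.
(* The first term adds up the jump probabilities over [m] steps. The second bounds the chance of
   passing [M]: [i.+1] grows in mean by a factor at most [1 + s *+ 2] per step, and [dM] makes the
   bound trivial from [M] on. *)
pose B m i := m%:R * (e * s) + d * i.+1%:R * (1 + s *+ 2) ^+ m.
have s2 : 0 <= s *+ 2 by rewrite mulrn_wge0 ?ltW.
have gB m : forall i, (N <= i)%N -> g (m%:R * s) i <= B m i.
  elim: m => [|m IH] k Nk.
    rewrite /g big1 => [|j _].
      by rewrite /B mul0r add0r expr0 mulr1 mulr_ge0.
    by rewrite mul0r (transition_0 Tp) gtn_eqF // (leq_trans (ltn_ord j)).
  have [Mk|kM] := leqP M k.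
    apply: le_trans (g1 _ _ _) _; first by rewrite mulr_ge0 // ltW.
    apply: le_trans dM _; rewrite /B -[leLHS]add0r; apply: lerD.
      by rewrite !mulr_ge0 // ltW.
    apply: (@le_trans _ _ (d * k.+1%:R)); first by rewrite ler_wpM2l // ler_nat.
    by rewrite ler_peMr ?mulr_ge0 // exprn_ege1 // lerDl.
  have [a2 b2] := Hs k (introT andP (conj Nk kM)).
  have ms0 : 0 <= m%:R * s by rewrite mulr_ge0 // ltW.
  (* Bound [g] by 1 at every state reached in the first step other than [k] and [k.+1]. *)
  have CK : g (s + m%:R * s) k <=
      1 + p s k k * (g (m%:R * s) k - 1)
        + p s k k.+1 * (g (m%:R * s) k.+1 - 1).
    have cv : series (fun l => \sum_(j < N) p s k l * p (m%:R * s) l j) @ \oo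
        --> g (s + m%:R * s) k.
      apply: (cvg_series_sum (f := fun j l => p s k l * p (m%:R * s) l j)) => j _.
      exact: transition_Chapman_Kolmogorov (ltW s0) ms0.
    have cv' := cvg_seriesD (cvg_seriesD (transition_sum1 Tp k (ltW s0))
      (@cvg_series_delta R k (p s k k * (g (m%:R * s) k - 1))))
      (@cvg_series_delta R k.+1 (p s k k.+1 * (g (m%:R * s) k.+1 - 1))).
    apply: (ler_cvg_series cv cv') => l.
    rewrite -big_distrr /= -/(g _ l).
    have [->|lk] := eqVneq l k.
      by rewrite ltn_eqF // mul1r mul0r addr0 mulrBr mulr1 addrC subrK.
    have [->|_] := eqVneq l k.+1.
      by rewrite mul1r mul0r addr0 mulrBr mulr1 addrC subrK.
    rewrite !mul0r !addr0 ler_piMr ?g1 //.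
    by apply: transition_ge0 => //; exact: ltW.
  have a0 : 0 <= p s k k by apply: transition_ge0 => //; exact: ltW.
  have b0 : 0 <= p s k k.+1 by apply: transition_ge0 => //; exact: ltW.
  have ab1 := transition_diag_succ_le1 k Tp (ltW s0).
  have IH0 := IH k Nk.
  have IH1 := IH k.+1 (leqW Nk).
  rewrite -natr1 mulrDl mul1r [_ + s]addrC; apply: le_trans CK _.
  move: IH0 IH1; set gk := g _ k; set gk1 := g _ k.+1 => IH0 IH1.
  (* Let a, b be the probabilities of [k] and [k.+1] after time [s], and X = d (1 + 2s)^m. The right
     side of [CK] is at most (1 - a - b) + (a + b) B_m(k) + b X. The bounds on 1 - a - b, a + b and
     b turn this into [B m.+1 k]. *)
  have E1 : B m k.+1 = B m k + d * (1 + s *+ 2) ^+ m.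
    by rewrite /B -[k.+2%:R]natr1; ring.
  have E2 : B m.+1 k = B m k + e * s
      + (k.+1%:R *+ 2 * s) * (d * (1 + s *+ 2) ^+ m).
    by rewrite /B exprS -[m.+1%:R]natr1 -mulr_natr; ring.
  have X0 : 0 <= d * (1 + s *+ 2) ^+ m.
    by rewrite mulr_ge0 // exprn_ge0 // addr_ge0.
  have BX0 : 0 <= B m k.
    by rewrite /B addr_ge0 // !mulr_ge0 // ?exprn_ge0 ?addr_ge0 // ltW.
  rewrite E1 in IH1; rewrite E2.
  move: (d * _) (B m k) (k.+1%:R *+ 2 * s) X0 BX0 IH0 IH1 a2 => X b c X0 bX0 IH0 IH1 a2.
  have h1 := ler_wpM2l a0 IH0; have h2 := ler_wpM2l b0 IH1.
  have h3 := ler_wpM2r X0 a2.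
  have h4 := ler_wpM2r bX0 ab1.
  lra.
move=> Ni; have := gB n.+1 i Ni.
rewrite mulfV ?pnatr_eq0 // => /le_trans; apply; rewrite /B.
have -> : n.+1%:R * (e * s) = e by rewrite mulrCA mulfV ?pnatr_eq0 ?mulr1.
rewrite lerD2l ler_wpM2l ?mulr_ge0 //.
have -> : 2 = n.+1%:R * (s *+ 2).
  by rewrite mulrnAr mulfV ?pnatr_eq0.
rewrite expRM_natl lerXn2r ?nnegrE ?expR_ge0 ?addr_ge0 ?(ltW s0) //.
exact: expR_ge1Dx.
Qed.

(** For an error [x], choose [d] to make the second term of the approximate bound equal to [x], then
    [M] from [d], then a step fine enough for the finitely many states below [M]. *)
Lemma Qprocess_hit_le Q p N e i : Qprocess Q p ->
    (forall i, Q i i.+1 = i.+1%:R) -> 0 < e ->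
    (forall i, (N <= i)%N -> - Q i i - Q i i.+1 < e) ->
    (N <= i)%N ->
  \sum_(j < N) p 1 i j <= e.
Proof.
move=> Qp Qup e0 Qe Ni; have Tp := Qprocess_transition Qp.
apply/ler_addgt0Pr => x x0.
pose d := x / (i.+1%:R * expR 2).
have d0 : 0 < d by rewrite divr_gt0 // mulr_gt0 // expR_gt0.
pose M := Num.truncn d^-1.
have dM : 1 <= d * M.+1%:R.
  rewrite mulrC -ler_pdivrMr // mul1r ltW //.
  by rewrite -truncn_lt_nat // invr_ge0 ltW.
have [n Hn] : exists n, forall k, (k < M)%N -> (N <= k)%N ->
    p n.+1%:R^-1 k k.+1 <= k.+1%:R *+ 2 * n.+1%:R^-1 /\
    1 - p n.+1%:R^-1 k k - p n.+1%:R^-1 k k.+1 <= e * n.+1%:R^-1.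
  apply: (near_right0_harmonic (P := fun s => forall k, (k < M)%N -> (N <= k)%N ->
    p s k k.+1 <= k.+1%:R *+ 2 * s /\ 1 - p s k k - p s k k.+1 <= e * s)).
  apply: near_forall_ltn => k _; have [Nk|kN] := leqP N k; last first.
    by near=> s.
  have kk : k != k.+1 by rewrite neq_ltn ltnSn.
  have H1 : \forall s \near 0^'+, p s k k.+1 <= k.+1%:R *+ 2 * s.
    by apply: Qprocess_near_le Qp kk _; rewrite Qup mulr2n ltrDl.
  have H2 := cvgr_le _ (cvgB (cvgN (@Qprocess_derivative _ _ _ Qp k k))
    (@Qprocess_derivative _ _ _ Qp k k.+1)) _ (Qe k Nk).
  near=> s => _; have s0 : 0 < s by near: s; exact: nbhs_right_gt.
  split; first by near: s; exact: H1.
  rewrite -ler_pdivrMr //.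
  have : - ((p s k k - (k == k)%:R) / s) - (p s k k.+1 - (k == k.+1)%:R) / s <= e.
    by near: s; exact: H2.
  rewrite eqxx mulr1n (negPf kk) subr0; congr (_ <= _); field; exact: lt0r_neq0.
have Hn' k : (N <= k < M)%N -> _ := fun H => let: conj Nk kM := andP H in Hn k kM Nk.
have := Qprocess_hit_le_approx Tp (ltW e0) (ltW d0) dM Hn' Ni.
congr (_ <= _ + _); by rewrite /d -mulrA divfK // mulf_neq0 ?pnatr_eq0.
Unshelve. all: by end_near. Qed.

End Qprocess.

(** * Decay against the lower bound for avoiding 0 *)

Unset Implicit Arguments.

Theorem lemma26 (R : realType) (Q : nat -> nat -> R) (alpha : nat -> R)
    (p : R -> nat -> nat -> R)
    (HQ : conservative_Qmatrix Q)
    (Q_up : forall i : nat, Q i i.+1 = i.+1%:R)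
    (Q_zero : forall i : nat, (1 <= i)%N -> Q i 0%N = alpha i)
    (Q_other : forall i j : nat,
      i != j -> j != i.+1 -> j != 0%N -> Q i j = 0)
    (alpha_ge0 : forall i : nat, (1 <= i)%N -> 0 <= alpha i)
    (alpha_infinite : infinite_set [set i : nat | (1 <= i)%N /\ alpha i != 0])
    (alpha_lim : alpha @ \oo --> (0 : R))
    (Hp : Qprocess Q p) :
  ~ exponentially_ergodic p.
Proof.
move=> [pi_ [Spi [beta beta0 conv]]].
have Tp := Qprocess_transition Hp.
have Qup i : 0 < Q i i.+1 by rewrite Q_up.
have P0 i j : 0 <= p 1 i j by exact: transition_ge0.
have P1 i : series (p 1 i) @ \oo --> (1 : R) by exact: transition_sum1.
have Qdiag i : (0 < i)%N -> - Q i i - Q i i.+1 = alpha i.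
  move=> i0; have cv := cvg_seriesD (@cvg_series_delta R 0%N (alpha i))
    (@cvg_series_delta R i.+1 (i.+1%:R)).
  have := @Qmatrix_conservative _ _ HQ i.
  rewrite [X in series X](_ : _ = fun k => (k == 0%N)%:R * alpha i +
    (k == i.+1)%:R * i.+1%:R).
    by move=> /(cvg_unique _ cv) <- //; rewrite Q_up addrK.
  apply/funext => k.
  have [->|ki] := eqVneq k i.
    by rewrite [i == 0%N]gtn_eqF // ltn_eqF // !mul0r addr0.
  have [->|k0] := eqVneq k 0%N; first by rewrite Q_zero // mul1r mul0r addr0.
  have [->|ki1] := eqVneq k i.+1; first by rewrite Q_up mul1r mul0r add0r.
  by rewrite Q_other ?mul0r ?addr0 // eq_sym.
(* Some [i] carries mass; climb from it in unit time to a [k] with [alpha k != 0], jump to 0 within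
   [s], and use invariance at time [1 + s]. *)
have pi0_gt0 : 0 < pi_ 0%N.
  have [i pii] : exists i, 0 < pi_ i.
    apply: contrapT => /forallNP pi0.
    suff : (1 : R) <= 0 by rewrite ler10.
    apply: (ler_cvg_series (stationary_sum1 Spi) (@cvg_series_delta R 0%N 0)) => k.
    rewrite mulr0.
    by have /negP := pi0 k; rewrite -leNgt.
  have [k [ik /= [k0 ak]]] : exists k, (i <= k)%N /\ (1 <= k)%N /\ alpha k != 0.
    apply: contrapT => noex; apply: alpha_infinite.
    apply: (sub_finite_set _ (finite_II i)) => k /= ak.
    by rewrite ltnNge; apply/negP => ik; apply: noex; exists k.
  near (0 : R)^'+ => s.
  have s0 : 0 < s by near: s; exact: nbhs_right_gt.
  have psk : 0 < p s k 0%N.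
    near: s; apply: Qprocess_near_gt0 Hp _ _; first by rewrite -lt0n.
    by rewrite Q_zero // lt_def ak alpha_ge0.
  have pik : 0 < p 1 i k by rewrite -(subnKC ik); exact: Qprocess_up_gt0 Hp Qup ltr01.
  have s10 : 0 <= 1 + s by rewrite addr_ge0 // ltW.
  apply: lt_le_trans (cvg_series_ge_term i _ (stationary_invariant Spi s10)).
    rewrite mulr_gt0 //.
    apply: lt_le_trans (transition_mul_le i 0%N k Tp ler01 (ltW s0)).
    exact: mulr_gt0.
  by move=> j; rewrite mulr_ge0 ?(stationary_ge0 Spi) ?(transition_ge0 Tp).
pose r := expR (- beta).
have r01 : 0 < r < 1 by rewrite expR_gt0 expR_lt1 oppr_lt0.
have [C [M [_ CM]]] := conv 0%N 0%N.
have rX n : r ^+ n = expR (- beta * n%:R) by rewrite mulrC expRM_natl.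
(* The assumed bound holds only beyond [M]. For [n <= M] the difference is at most 1, and expR (beta
   * M) * r ^+ n is at least 1. *)
have decay n : `|p n%:R 0%N 0%N - pi_ 0%N| <= (`|C| + expR (beta * M)) * r ^+ n.
  have [Mn|nM] := ltP M n%:R.
    apply: le_trans (CM _ Mn) _; rewrite rX ler_wpM2r ?expR_ge0 //.
    by rewrite (le_trans (ler_norm _)) // lerDl expR_ge0.
  have pn0 : 0 <= p n%:R 0%N 0%N by exact: transition_ge0.
  have pn1 : p n%:R 0%N 0%N <= 1 by exact: transition_le1.
  have pi1 : pi_ 0%N <= 1.
    exact: cvg_series_ge_term (stationary_ge0 Spi) (stationary_sum1 Spi).
  apply: (@le_trans _ _ 1).
    by rewrite ler_norml; apply/andP; split; lra.
  rewrite rX mulrDl -expRD -[leLHS]add0r; apply: lerD.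
    by rewrite mulr_ge0 ?expR_ge0.
  by rewrite -[leLHS]expR0 ler_expR mulNr -mulrBr pmulr_rge0 ?subr_ge0.
have bd n i := (avoid0_bounds n i P0 P1).
have [K [rho [/andP[rho0 rho1] Kdecay]]] : exists K rho, 0 < rho < 1 /\
    forall n, avoid0 (p 1) n 0%N <= K * rho ^+ n.
  apply: (renewal_decay (u := fun n => p n%:R 0%N 0%N) pi0_gt0 r01 _ _ _ decay).
  - by move=> n; exact: transition_ge0.
  - by move=> n; have [/andP[]] := bd n 0%N.
  - move=> n; rewrite big_ord_recl (transition_0 Tp) eqxx mul1r subn0.
    exact: avoid0_renewal.
(* This makes [1 - e] the midpoint of [rho] and 1, hence larger than [rho]. *)
pose e := (1 - rho) / 2.
have e0 : 0 < e by rewrite /e; lra.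
have e1 : e <= 1 by rewrite /e; lra.
have [N0 _ aN] := cvgr_lt _ alpha_lim _ e0.
(* The successor makes [N] positive, as [avoid0_ge] and [Qdiag] require. *)
pose N := N0.+1.
have hitN i : (N <= i)%N -> \sum_(j < N) p 1 i j <= e.
  apply: (Qprocess_hit_le Hp Q_up e0) => k Nk.
  by rewrite Qdiag ?(leq_trans _ Nk) //; apply: aN; exact: ltnW.
pose c := p 1 0%N N.
have c0 : 0 < c by rewrite /c -[N]add0n; exact: Qprocess_up_gt0 Hp Qup ltr01.
have lower n : c * (1 - e) ^+ n <= avoid0 (p 1) n.+1 0%N.
  have [_ cv] := bd n 0%N.
  apply: le_trans (cvg_series_ge_term N _ cv) => [|k].
    rewrite mul1r; apply: (ler_wpM2l (ltW c0)).
    exact: (avoid0_ge n P0 P1 (ltn0Sn N0) e1 hitN (leqnn N)).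
  by have [/andP[? _] _] := bd n k; rewrite !mulr_ge0.
have th0 : 0 < 1 - e by rewrite /e; lra.
(* [lower] and [Kdecay] at [n.+1] give [c <= K * rho * z ^+ n], whose right side tends to 0. *)
pose z := rho / (1 - e).
have z1 : `|z| < 1.
  rewrite gtr0_norm ?divr_gt0 // /z ltr_pdivrMr // mul1r /e; lra.
have cz : (fun n => K * rho * z ^+ n) @ \oo --> K * rho * 0.
  by apply: cvgMr; exact: cvg_expr.
suff : c <= K * rho * 0 by rewrite mulr0 leNgt c0.
apply: (cvgr_to_ge cz); near=> n.
rewrite /z expr_div_n mulrA ler_pdivlMr ?exprn_gt0 //.
by rewrite (le_trans (lower n)) // (le_trans (Kdecay _)) // exprS mulrA.
Unshelve. all: by end_near. Qed.
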